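(* For all $\phi,\psi\in\mathfrak M$, $$\lim_{\varepsilon\to0}\mathfrak t_\varepsilon[\psi,\phi]=\mathfrak t_{\rm AB}[\psi,\phi].$$
   Context: Work in $L^2(\mathbb{R})$ with $(f,g)=\int\overline{f}g\,dx$; $q$ is multiplication by $x$, $p=-i\,d/dx$, $t=q^{-1}p$ with $D(t)=\{f\in D(p):pf\in D(q^{-1})\}$, $t^*$ its adjoint; $L^2_0$, $L^2_1$ the even/odd subspaces. For $0<\varepsilon\le1$ define $S_\varepsilon$ in $L^2_0$ by $D(S_\varepsilon)=\{f\in L^2_0\cap\bigcap_nD(t^{2n+1}):\sum_{n=0}^N\frac{(-1)^n}{2n+1}(\sqrt\varepsilon t)^{2n+1}f$ converges in norm$\}$, $S_\varepsilon f=-\varepsilon^{-1/2}\sum_{n\ge0}\frac{(-1)^n}{2n+1}(\sqrt\varepsilon t)^{2n+1}f$, and $S^*_\varepsilon$ (notation only) in $L^2_1$ by the same formulas with $t^*$ and $L^2_1$. Let $\mathfrak M_0$ be the span of $\{x^{2n}e^{-\alpha x^2/2}:n\ge0,\alpha\in(0,1)\}$, $\mathfrak M_1$ the span of $\{x^{2n+1}e^{-\alpha x^2/2}:n\ge0,\alpha\in(0,1)\}$, and $\mathfrak M=\mathfrak M_0\oplus\mathfrak M_1$ (one has $\mathfrak M_0\subset D(S_\varepsilon)\cap D(t)$ and $\mathfrak M_1\subset D(S^*_\varepsilon)\cap D(t^* )$ for all $0<\varepsilon\le1$). For $\psi=\psi_0\oplus\psi_1$, $\phi=\phi_0\oplus\phi_1\in\mathfrak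 M$ set $\mathfrak t_\varepsilon[\psi,\phi]=\frac12((\psi_0,S_\varepsilon\phi_0)+(S_\varepsilon\psi_0,\phi_0))+\frac12((\psi_1,S^*_\varepsilon\phi_1)+(S^*_\varepsilon\psi_1,\phi_1))$ and $\mathfrak t_{\rm AB}[\psi,\phi]=-\frac12((\psi_0,t\phi_0)+(t\psi_0,\phi_0))-\frac12((\psi_1,t^*\phi_1)+(t^*\psi_1,\phi_1))$. *)

(* Defs.v *)
From mathcomp Require Import all_boot all_order all_algebra.
Import Order.TTheory GRing.Theory Num.Theory.
From mathcomp Require Import all_classical all_reals all_analysis.
From mathcomp.real_closed Require Import complex.
Import numFieldNormedType.Exports.

Set Implicit Arguments.
Unset Strict Implicit.
Unset Printing Implicit Defensive.

Local Open Scope classical_set_scope.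
Local Open Scope ring_scope.
Local Open Scope complex_scope.

(* Functions R -> C are representatives of elements of L^2(R); everything below
   is invariant under modification on Lebesgue-null sets. *)

Definition sqmod {R : realType} (z : R[i]) : R := Re z ^+ 2 + Im z ^+ 2.

Definition L2 {R : realType} (f : R -> R[i]) : Prop :=
  [/\ measurable_fun setT (fun x => Re (f x)),
      measurable_fun setT (fun x => Im (f x)) &
      (\int[@lebesgue_measure R]_x (sqmod (f x))%:E < +oo)%E].

Definition ae_eq {R : realType} (f g : R -> R[i]) : Prop :=
  {ae @lebesgue_measure R, forall x, f x = g x}.

Definition cint {R : realType} (D : set R) (f : R -> R[i]) : R[i] :=
  (Rintegral (@lebesgue_measure R) D (fun x => Re (f x)))
  +i* (Rintegral (@lebesgue_measure R) D (fun x => Im (f x))).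

Definition inner {R : realType} (f g : R -> R[i]) : R[i] :=
  cint setT (fun x => (f x)^* * g x).

Definition dist2 {R : realType} (f g : R -> R[i]) : \bar R :=
  (\int[@lebesgue_measure R]_x (sqmod (f x - g x))%:E)%E.

Definition L2_cvg {R : realType} (u : nat -> R -> R[i]) (L : R -> R[i]) : Prop :=
  L2 L /\ dist2 (u n) L @[n --> \oo] --> (0 : \bar R)%E.

(* Operators are encoded as relations: [T f g] means f \in D(T) and T f = g
   (as elements of L^2, i.e. up to null sets). *)

(* p = -i d/dx with its natural (self-adjoint) domain H^1(R):
   f has an absolutely continuous representative F with F' = i (p f) in L^2. *)
Definition p_rel {R : realType} (f h : R -> R[i]) : Prop :=
  [/\ L2 f, L2 h &
      exists F : R -> R[i], ae_eq f F /\
        forall a b : R, a <= b -> F b - F a = 'i * cint `[a, b] h].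

Definition qinv_rel {R : realType} (f g : R -> R[i]) : Prop :=
  [/\ L2 f, L2 g & ae_eq g (fun x => f x / x%:C)].

Definition t_rel {R : realType} (f g : R -> R[i]) : Prop :=
  exists h, p_rel f h /\ qinv_rel h g.

Definition tstar_rel {R : realType} (g h : R -> R[i]) : Prop :=
  [/\ L2 g, L2 h & forall f k, t_rel f k -> inner g k = inner h f].

Fixpoint relpow {R : realType} (T : (R -> R[i]) -> (R -> R[i]) -> Prop) (n : nat)
  (f g : R -> R[i]) : Prop :=
  match n with
  | 0 => L2 f /\ ae_eq f g
  | n'.+1 => exists h, relpow T n' f h /\ T h g
  end.

Definition even_L2 {R : realType} (f : R -> R[i]) : Prop :=
  L2 f /\ ae_eq (fun x => f (- x)) f.
Definition odd_L2 {R : realType} (f : R -> R[i]) : Prop :=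
  L2 f /\ ae_eq (fun x => f (- x)) (fun x => - f x).

Definition Scoef {R : realType} (eps : R) (n : nat) : R :=
  (-1) ^+ n / (2 * n + 1)%:R * (Num.sqrt eps) ^+ (2 * n + 1).

(* S_eps built from the operator T on the subspace P:
   f in P /\ f in D(T^(2n+1)) for all n, the partial sums
   sum_{n<=N} (-1)^n/(2n+1) (sqrt eps T)^(2n+1) f converge in norm to L,
   and g = - eps^{-1/2} L.  With T = t, P = L^2_0 this is S_eps;
   with T = t^*, P = L^2_1 this is S^*_eps. *)
Definition S_rel {R : realType} (T : (R -> R[i]) -> (R -> R[i]) -> Prop)
  (P : (R -> R[i]) -> Prop) (eps : R) (f g : R -> R[i]) : Prop :=
  [/\ P f, L2 g &
      exists u : nat -> R -> R[i],
        (forall n, relpow T (2 * n + 1) f (u n)) /\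
        exists L : R -> R[i],
          L2_cvg (fun N x => \sum_(n < N.+1) (Scoef eps n)%:C * u n x) L /\
          ae_eq g (fun x => - ((Num.sqrt eps)^-1)%:C * L x)].

Definition M0 {R : realType} (f : R -> R[i]) : Prop :=
  exists s : seq (R[i] * nat * R),
    all (fun k => 0 < k.2 < 1) s /\
    f = (fun x => \sum_(k <- s) k.1.1 * (x ^+ (2 * k.1.2) * expR (- k.2 * x ^+ 2 / 2))%:C).
Definition M1 {R : realType} (f : R -> R[i]) : Prop :=
  exists s : seq (R[i] * nat * R),
    all (fun k => 0 < k.2 < 1) s /\
    f = (fun x => \sum_(k <- s) k.1.1 * (x ^+ (2 * k.1.2 + 1) * expR (- k.2 * x ^+ 2 / 2))%:C).

(* the forms, given the values S_eps psi0, S_eps phi0, S^*_eps psi1, S^*_eps phi1 *)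
Definition t_eps_form {R : realType} (psi0 psi1 phi0 phi1 Spsi0 Sphi0 Spsi1 Sphi1 : R -> R[i])
  : R[i] :=
  2%:R^-1 * (inner psi0 Sphi0 + inner Spsi0 phi0)
  + 2%:R^-1 * (inner psi1 Sphi1 + inner Spsi1 phi1).

Definition t_AB_form {R : realType} (psi0 psi1 phi0 phi1 tpsi0 tphi0 tpsi1 tphi1 : R -> R[i])
  : R[i] :=
  - (2%:R^-1 * (inner psi0 tphi0 + inner tpsi0 phi0))
  - 2%:R^-1 * (inner psi1 tphi1 + inner tpsi1 phi1).

(* Main.v *)
(* Convergence of the series defining S_eps at eps = 1 bounds its terms
   t^(2n+1) phi / (2n+1), at least when paired with a fixed psi.  For eps < 1 the
   pairing (psi, S_eps phi) is therefore, up to sign, a power series in eps with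
   bounded coefficients and constant term (psi, t phi), so it tends to
   - (psi, t phi) as eps -> 0; no explicit formula for t^(2n+1) on Gaussians is
   needed.  The same series serves every eps because t and t^* are single-valued
   modulo null sets: for t by Lebesgue differentiation, for t^* because D(t)
   contains enough trapezoidal functions, namely those whose derivative vanishes
   near 0. *)

Require Import Defs.
From mathcomp Require Import all_boot all_order all_algebra.
Import Order.TTheory GRing.Theory Num.Theory.
From mathcomp Require Import all_classical all_reals all_analysis.
From mathcomp.real_closed Require Import complex.
From mathcomp Require Import measurable_realfun ring lra.
Import numFieldNormedType.Exports.

Local Open Scope classical_set_scope.
Local Open Scope ring_scope.
Local Open Scope complex_scope.

(** * The real part of the inner product *)

Lemma ae_imply (R : realType) (P Q : R -> Prop) : (forall x, P x -> Q x) ->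
  {ae @lebesgue_measure R, forall x, P x} ->
  {ae @lebesgue_measure R, forall x, Q x}.
Proof.
by move=> PQ; apply: filterS => //; exact: (ae_filter_ringOfSetsType lebesgue_measure).
Qed.

Lemma ae_all (R : realType) (P : R -> Prop) : (forall x, P x) ->
  {ae @lebesgue_measure R, forall x, P x}.
Proof.
by apply: filterE; exact: (ae_filter_ringOfSetsType lebesgue_measure).
Qed.

Lemma ae_conj (R : realType) (P Q : R -> Prop) :
  {ae @lebesgue_measure R, forall x, P x} ->
  {ae @lebesgue_measure R, forall x, Q x} ->
  {ae @lebesgue_measure R, forall x, P x /\ Q x}.
Proof.
by apply: filterI; exact: (ae_filter_ringOfSetsType lebesgue_measure).
Qed.

Lemma sqmod_ge0 (R : realType) (z : R[i]) : 0 <= sqmod z.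
Proof. by rewrite addr_ge0 ?sqr_ge0. Qed.

Lemma measurable_sqmod (R : realType) (f : R -> R[i]) :
  measurable_fun setT (fun x => Re (f x)) ->
  measurable_fun setT (fun x => Im (f x)) ->
  measurable_fun setT (fun x => sqmod (f x)).
Proof.
by move=> mr mi; apply: measurable_funD; apply: measurable_funX.
Qed.

Lemma L2_integrable (R : realType) (f : R -> R[i]) : L2 f ->
  (@lebesgue_measure R).-integrable setT (fun x => (sqmod (f x))%:E).
Proof.
move=> [mr mi foo]; apply/integrableP; split.
  by apply/measurable_EFinP; exact: measurable_sqmod.
rewrite (_ : (fun _ => _) = (fun x => (sqmod (f x))%:E))//.
by apply/funext => x; rewrite gee0_abs// lee_fin sqmod_ge0.
Qed.

Lemma integrable_L2 (R : realType) (f : R -> R[i]) (g : R -> R) :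
  measurable_fun setT (fun x => Re (f x)) ->
  measurable_fun setT (fun x => Im (f x)) ->
  (@lebesgue_measure R).-integrable setT (EFin \o g) ->
  (forall x, sqmod (f x) <= g x) -> L2 f.
Proof.
move=> mr mi ig fg; split=> //.
have : (@lebesgue_measure R).-integrable setT (fun x => (sqmod (f x))%:E).
  apply: le_integrable ig => //.
    by apply/measurable_EFinP; exact: measurable_sqmod.
  move=> x _ /=; rewrite lee_fin ger0_norm ?sqmod_ge0//.
  by rewrite (le_trans (fg x))// ler_norm.
move=> /integrableP[_]; rewrite (_ : (fun _ => _) = (fun x => (sqmod (f x))%:E))//.
by apply/funext => x; rewrite gee0_abs// lee_fin sqmod_ge0.
Qed.

Lemma L2D (R : realType) (f g : R -> R[i]) : L2 f -> L2 g ->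
  L2 (fun x => f x + g x).
Proof.
move=> f2 g2; have [mfr mfi _] := f2; have [mgr mgi _] := g2.
apply: (@integrable_L2 _ _ (fun x => 2 * (sqmod (f x) + sqmod (g x)))).
- rewrite (_ : (fun _ => _) = (fun x => Re (f x) + Re (g x))).
    exact: measurable_funD.
  by apply/funext => x; rewrite raddfD.
- rewrite (_ : (fun _ => _) = (fun x => Im (f x) + Im (g x))).
    exact: measurable_funD.
  by apply/funext => x; rewrite raddfD.
- exact: (integrableZl measurableT 2 (integrableD measurableT
    (L2_integrable _ _ f2) (L2_integrable _ _ g2))).
- move=> x; case: (f x) (g x) => [a b] [c e]; rewrite /sqmod /=.
  by have := sqr_ge0 (a - c); have := sqr_ge0 (b - e); lra.
Qed.

Lemma L2Z (R : realType) (c : R[i]) (f : R -> R[i]) : L2 f ->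
  L2 (fun x => c * f x).
Proof.
move=> f2; have [mfr mfi _] := f2.
apply: (@integrable_L2 _ _ (fun x => sqmod c * sqmod (f x))).
- rewrite (_ : (fun _ => _) = (fun x => Re c * Re (f x) - Im c * Im (f x))).
    by apply: measurable_funB; apply: measurable_funM.
  by apply/funext => x; case: c (f x) => [? ?] [? ?].
- rewrite (_ : (fun _ => _) = (fun x => Re c * Im (f x) + Im c * Re (f x))).
    by apply: measurable_funD; apply: measurable_funM.
  by apply/funext => x; case: c (f x) => [? ?] [? ?].
- exact: (integrableZl measurableT (sqmod c) (L2_integrable _ _ f2)).
- by move=> x; case: c (f x) => [a b] [e h]; rewrite /sqmod /= le_eqVlt;
    apply/orP; left; apply/eqP; ring.
Qed.

Lemma L2B (R : realType) (f g : R -> R[i]) : L2 f -> L2 g ->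
  L2 (fun x => f x - g x).
Proof.
move=> f2 /(@L2Z _ (-1)) g2; have := L2D _ _ _ f2 g2.
by congr L2; apply/funext => x; rewrite mulN1r.
Qed.

Lemma L2_sum (R : realType) (c : nat -> R[i]) (u : nat -> R -> R[i]) n :
  (forall k, L2 (u k)) -> L2 (fun x => \sum_(k < n.+1) c k * u k x).
Proof.
move=> u2; elim: n => [|n IHn].
  have := L2Z _ (c 0%N) _ (u2 0%N).
  by congr L2; apply/funext => x; rewrite big_ord_recr big_ord0 /= add0r.
have := L2D _ _ _ IHn (L2Z _ (c n.+1) _ (u2 n.+1)).
by congr L2; apply/funext => x; rewrite [RHS]big_ord_recr.
Qed.

(** The limits are taken for this real pairing, so that only integrals of real functions occur.
    [Im_inner] and [Im_innerC] recover the imaginary part by rotating one argument by ['i] or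
    [- 'i]. *)
Definition reinner {R : realType} (f g : R -> R[i]) : R :=
  Rintegral (@lebesgue_measure R) setT
    (fun x => Re (f x) * Re (g x) + Im (f x) * Im (g x)).

Lemma Re_inner (R : realType) (f g : R -> R[i]) : Re (inner f g) = reinner f g.
Proof.
by apply: eq_Rintegral => x _; case: (f x) (g x) => [? ?] [? ?] /=; ring.
Qed.

Lemma Im_inner (R : realType) (f g : R -> R[i]) :
  Im (inner f g) = reinner (fun x => 'i * f x) g.
Proof.
by apply: eq_Rintegral => x _; case: (f x) (g x) => [? ?] [? ?] /=; ring.
Qed.

(** Swapping the arguments puts [f] in the second slot, where [reinner_cvg] passes to the limit;
    this serves the terms in which the first argument of [inner] varies. *)
Lemma Im_innerC (R : realType) (f g : R -> R[i]) :
  Im (inner f g) = reinner (fun x => - 'i * g x) f.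
Proof.
by apply: eq_Rintegral => x _; case: (f x) (g x) => [? ?] [? ?] /=; ring.
Qed.

Lemma reinnerC (R : realType) (f g : R -> R[i]) : reinner f g = reinner g f.
Proof. by apply: eq_Rintegral => x _; ring. Qed.

Lemma integrable_reinner (R : realType) (f g : R -> R[i]) : L2 f -> L2 g ->
  (@lebesgue_measure R).-integrable setT
    (EFin \o (fun x => Re (f x) * Re (g x) + Im (f x) * Im (g x))).
Proof.
move=> f2 g2; have [mfr mfi _] := f2; have [mgr mgi _] := g2.
have iD := integrableD measurableT (L2_integrable _ _ f2) (L2_integrable _ _ g2).
apply: le_integrable iD => //.
  by apply/measurable_EFinP; apply: measurable_funD; apply: measurable_funM.
move=> x _ /=; rewrite lee_fin [leRHS]ger0_norm ?addr_ge0 ?sqr_ge0//.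
case: (f x) (g x) => [a b] [c e]; rewrite ler_norml /sqmod /=.
have := sqr_ge0 (a - c); have := sqr_ge0 (b - e).
have := sqr_ge0 (a + c); have := sqr_ge0 (b + e).
have := sqr_ge0 a; have := sqr_ge0 b; have := sqr_ge0 c; have := sqr_ge0 e.
by move=> *; apply/andP; split; lra.
Qed.

Lemma reinnerD (R : realType) (f g h : R -> R[i]) : L2 f -> L2 g -> L2 h ->
  reinner f (fun x => g x + h x) = reinner f g + reinner f h.
Proof.
move=> f2 g2 h2; rewrite /reinner -RintegralD//; try exact: integrable_reinner.
by apply: eq_Rintegral => x _; rewrite !raddfD /=; ring.
Qed.

Lemma reinnerZ (R : realType) (a : R) (f g : R -> R[i]) : L2 f -> L2 g ->
  reinner f (fun x => a%:C * g x) = a * reinner f g.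
Proof.
move=> f2 g2; rewrite /reinner -RintegralZl//; try exact: integrable_reinner.
by apply: eq_Rintegral => x _; case: (f x) (g x) => [? ?] [? ?] /=; ring.
Qed.

Lemma reinnerB (R : realType) (f g h : R -> R[i]) : L2 f -> L2 g -> L2 h ->
  reinner f (fun x => g x - h x) = reinner f g - reinner f h.
Proof.
move=> f2 g2 h2; rewrite -mulN1r -reinnerZ// -reinnerD//; last exact: L2Z.
by congr reinner; apply/funext => x; rewrite raddfN mulN1r.
Qed.

Lemma reinner_sum (R : realType) (f : R -> R[i]) (c : nat -> R)
    (u : nat -> R -> R[i]) n : L2 f -> (forall k, L2 (u k)) ->
  reinner f (fun x => \sum_(k < n.+1) (c k)%:C * u k x) =
  \sum_(k < n.+1) c k * reinner f (u k).
Proof.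
move=> f2 u2; elim: n => [|n IHn].
  rewrite big_ord_recr big_ord0 /= add0r -reinnerZ//; congr reinner.
  by apply/funext => x; rewrite big_ord_recr big_ord0 /= add0r.
rewrite big_ord_recr /= -IHn -reinnerZ// -reinnerD//.
- by congr reinner; apply/funext => x; rewrite big_ord_recr.
- exact: (L2_sum _ (fun k => (c k)%:C)).
- exact: L2Z.
Qed.

Lemma reinner_ae (R : realType) (f g h : R -> R[i]) : L2 f -> L2 g -> L2 h ->
  Defs.ae_eq g h -> reinner f g = reinner f h.
Proof.
move=> f2 g2 h2 gh; rewrite /reinner /Rintegral; congr fine.
apply: ae_eq_integral => //.
- by case/integrableP: (integrable_reinner _ _ _ f2 g2).
- by case/integrableP: (integrable_reinner _ _ _ f2 h2).
- by apply: ae_imply gh => x /= -> .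
Qed.

(** Expand $l^{-1}(la\mp b/2)^2\ge0$. The free weight [l] lets this bound stand in for the
    Cauchy-Schwarz inequality in [reinner_cvg]. *)
Lemma weighted_amgm (R : realType) (l a b : R) : 0 < l ->
  `|a * b| <= l * a ^+ 2 + l^-1 * b ^+ 2.
Proof.
move=> l0; have lV : l * l^-1 = 1 by rewrite divff ?gt_eqF.
have p0 : 0 < l^-1 by rewrite invr_gt0.
have h1 := mulr_ge0 (ltW p0) (sqr_ge0 (l * a - b / 2)).
have h2 := mulr_ge0 (ltW p0) (sqr_ge0 (l * a + b / 2)).
have h3 := mulr_ge0 (ltW p0) (sqr_ge0 b).
have e1 : l^-1 * (l * a - b / 2) ^+ 2 =
    l * l^-1 * (l * a ^+ 2 - a * b) + l^-1 * b ^+ 2 / 4 by field; exact: lt0r_neq0.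
have e2 : l^-1 * (l * a + b / 2) ^+ 2 =
    l * l^-1 * (l * a ^+ 2 + a * b) + l^-1 * b ^+ 2 / 4 by field; exact: lt0r_neq0.
rewrite e1 lV in h1; rewrite e2 lV in h2.
by rewrite ler_norml; apply/andP; split; lra.
Qed.

(** Norm convergence implies weak convergence: for every weight [l > 0] the error is at most
    $l\|f\|^2+\|u_n-L\|^2/l$, so one fixes a small [l] first and then takes [n] large. *)
Lemma reinner_cvg (R : realType) (f L : R -> R[i]) (u : nat -> R -> R[i]) :
  L2 f -> (forall n, L2 (u n)) -> L2_cvg u L ->
  reinner f (u n) @[n --> \oo] --> reinner f L.
Proof.
move=> f2 u2 [L2L uL].
pose F := Rintegral (@lebesgue_measure R) setT (fun x => sqmod (f x)).
have F0 : 0 <= F by apply: Rintegral_ge0 => x _; exact: sqmod_ge0.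
have key n l : 0 < l ->
    `|reinner f L - reinner f (u n)| <= l * F + fine (dist2 (u n) L) / l.
  move=> l0; rewrite distrC -reinnerB//.
  have d2 : L2 (fun x => u n x - L x) by exact: L2B.
  have ifd := integrable_reinner _ _ _ f2 d2.
  have := le_normr_Rintegral measurableT ifd => /le_trans; apply.
  have -> : fine (dist2 (u n) L) / l =
      Rintegral (@lebesgue_measure R) setT (fun x => l^-1 * sqmod (u n x - L x)).
    by rewrite RintegralZl//; [rewrite mulrC | exact: L2_integrable].
  rewrite /F -RintegralZl//; last exact: L2_integrable.
  rewrite -RintegralD//.
  - apply: le_Rintegral => //.
    + exact: (integrable_norm ifd).
    + exact: (integrableD measurableT (integrableZl measurableT l (L2_integrable _ _ f2))
        (integrableZl measurableT l^-1 (L2_integrable _ _ d2))).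
    + move=> x _; case: (f x) (u n x - L x) => [a b] [c e]; rewrite /sqmod /=.
      have := weighted_amgm _ l a c l0; have := weighted_amgm _ l b e l0.
      by have := ler_normD (a * c) (b * e); lra.
  - exact: (integrableZl measurableT l (L2_integrable _ _ f2)).
  - exact: (integrableZl measurableT l^-1 (L2_integrable _ _ d2)).
have fd : (fine (dist2 (u n) L) @[n --> \oo] --> 0).
  exact: (fine_cvg uL).
apply/cvgrPdist_le => e e0.
(* This weight makes [l * F] at most [e / 2]; the [+ 1] covers [F = 0]. The distance is then
   required to be at most [e * l / 2]. *)
pose l := e / (2 * (F + 1)).
have l0 : 0 < l by rewrite divr_gt0// mulr_gt0// ltr_wpDl.
have el0 : 0 < e * l / 2 by rewrite divr_gt0// mulr_gt0.
move/cvgrPdist_le : fd => /(_ _ el0).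
apply: filterS => n; rewrite sub0r normrN => nl.
apply: (le_trans (key n l l0)).
have lF : l * F <= e / 2.
  rewrite /l mulrAC ler_pdivrMr ?mulr_gt0 ?ltr_wpDl//.
  nra.
have : fine (dist2 (u n) L) / l <= e / 2.
  rewrite ler_pdivrMr//; apply: (le_trans (ler_norm _)); apply: (le_trans nl).
  by rewrite mulrAC.
lra.
Qed.

(** * The limit of the arctangent series *)

(** $(\sqrt\varepsilon)^{2n+1}=\sqrt\varepsilon\,\varepsilon^n$: up to the factor
    $\sqrt\varepsilon$, the series is a power series in $\varepsilon$ whose coefficients are the
    terms at $\varepsilon=1$. *)
Lemma Scoef_expand (R : realType) (eps : R) n : 0 < eps ->
  Scoef eps n = Num.sqrt eps * eps ^+ n * Scoef 1 n.
Proof.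
move=> e0; rewrite /Scoef sqrtr1 expr1n mulr1 addn1 exprS mulnC [X in _ * (_ * X)]exprM.
rewrite exprAC sqr_sqrtr ?ltW//; ring.
Qed.

(** Convergence at [eps = 1] bounds all terms there by some [M]. For [eps <= 1/2] the terms with
    $n\ge1$ are then dominated by a geometric series and sum to at most
    $2M\sqrt\varepsilon\,\varepsilon$, which is $O(\varepsilon)$ after division by
    $\sqrt\varepsilon$. *)
Lemma scaled_series_limit (R : realType) (c : nat -> R) (L : R -> R) :
  (forall eps, 0 < eps <= 1 ->
    \sum_(n < N.+1) Scoef eps n * c n @[N --> \oo] --> L eps) ->
  - (Num.sqrt eps)^-1 * L eps @[eps --> 0^'+] --> - c 0%N.
Proof.
move=> cL.
have [M M0 bM] : exists2 M, 0 < M & forall n, `|Scoef 1 n * c n| <= M.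
  have cvS : cvgn (fun N => \sum_(n < N.+1) Scoef 1 n * c n).
    by apply/cvg_ex; exists (L 1); apply: cL; rewrite ltr01 lexx.
  have [M M0 {}hM] := pinfty_ex_gt0 (cvg_seq_bounded cvS).
  have {}hM N : `|\sum_(n < N.+1) Scoef 1 n * c n| <= M by exact: hM.
  (* Each term is the difference of two consecutive partial sums, both bounded by [M]. *)
  exists (2 * M) => [|[|n]]; first by rewrite mulr_gt0.
    by have := hM 0%N; rewrite big_ord_recr big_ord0 /= add0r; lra.
  have := hM n.+1; rewrite big_ord_recr /= => h1; have h2 := hM n.
  set P := \sum_(i < n.+1) _ in h1 h2.
  have -> : Scoef 1 n.+1 * c n.+1 = (P + Scoef 1 n.+1 * c n.+1) - P by ring.
  by apply: (le_trans (ler_normB _ _)); lra.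
have Scoef10 : Scoef 1 0 = 1 :> R.
  by rewrite /Scoef sqrtr1 expr1n expr0 mulr1 muln0 add0n divr1.
(* The subtracted power makes the induction close: from [N] to [N + 1] the bound gains
   $2M\sqrt\varepsilon\,\varepsilon^{N+1}(1-\varepsilon)$, which covers the new term because
   $1-\varepsilon\ge1/2$. *)
have partial eps N : 0 < eps <= 2^-1 ->
    `|\sum_(n < N.+1) Scoef eps n * c n - Num.sqrt eps * c 0%N| <=
    2 * M * Num.sqrt eps * (eps - eps ^+ N.+1).
  move=> /andP[e0 e2]; have s0 : 0 < Num.sqrt eps by rewrite sqrtr_gt0.
  elim: N => [|N IHN].
    rewrite big_ord_recr big_ord0 /= add0r Scoef_expand// Scoef10 expr0 !mulr1 subrr normr0.
    by rewrite expr1 subrr mulr0.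
  rewrite big_ord_recr /= addrAC (le_trans (ler_normD _ _))//.
  have -> : Scoef eps N.+1 * c N.+1 =
      Num.sqrt eps * eps ^+ N.+1 * (Scoef 1 N.+1 * c N.+1).
    by rewrite Scoef_expand//; ring.
  have p0 : 0 < eps ^+ N.+1 by rewrite exprn_gt0.
  have sp0 := mulr_gt0 s0 p0.
  rewrite normrM (gtr0_norm sp0).
  have h1 := ler_wpM2l (ltW sp0) (bM N.+1).
  apply: (le_trans (lerD IHN h1)).
  rewrite [eps ^+ N.+2]exprS.
  have := mulr_ge0 (mulr_ge0 (ltW M0) (ltW sp0)) (_ : 0 <= 2^-1 - eps).
  rewrite subr_ge0 => /(_ e2).
  by set s := Num.sqrt eps; set p := eps ^+ N.+1; lra.
have bound eps : 0 < eps <= 2^-1 ->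
    `|- c 0%N - (- (Num.sqrt eps)^-1 * L eps)| <= 2 * M * eps.
  move=> e12; have /andP[e0 e2] := e12.
  have s0 : 0 < Num.sqrt eps by rewrite sqrtr_gt0.
  have e1 : 0 < eps <= 1 by rewrite e0 (le_trans e2)// invf_le1// ler1n.
  have h : `|L eps - Num.sqrt eps * c 0%N| <= 2 * M * Num.sqrt eps * eps.
    have cv : `|\sum_(n < N.+1) Scoef eps n * c n - Num.sqrt eps * c 0%N| @[N --> \oo]
        --> `|L eps - Num.sqrt eps * c 0%N|.
      by apply: cvg_norm; apply: cvgB; [exact: cL | exact: cvg_cst].
    apply: (cvgr_to_le cv); apply: nearW => N.
    apply: (le_trans (partial eps N e12)); apply: ler_wpM2l.
      by rewrite ltW// !mulr_gt0.
    by rewrite gerBl exprn_ge0// ltW.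
  have -> : - c 0%N - (- (Num.sqrt eps)^-1 * L eps) =
      (Num.sqrt eps)^-1 * (L eps - Num.sqrt eps * c 0%N).
    by field; exact: lt0r_neq0.
  rewrite normrM gtr0_norm ?invr_gt0// mulrC ler_pdivrMr//.
  by apply: (le_trans h); rewrite le_eqVlt; apply/orP; left; apply/eqP; ring.
apply/cvgrPdist_le => e e0.
near=> eps.
apply: (le_trans (bound eps _)).
  apply/andP; split; first by near: eps; exact: nbhs_right_gt.
  by near: eps; apply: nbhs_right_le; rewrite invr_gt0.
have : eps <= e / (2 * M).
  by near: eps; apply: nbhs_right_le; rewrite divr_gt0// mulr_gt0.
by rewrite ler_pdivlMr ?mulr_gt0// mulrC.
Unshelve. all: by end_near.
Qed.

(** Single-valuedness on classes modulo null sets. The arguments too are compared only almost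
    everywhere, since in [relpow] each intermediate value is itself known only up to a null set. *)
Definition ae_functional {R : realType}
    (T : (R -> R[i]) -> (R -> R[i]) -> Prop) : Prop :=
  forall f f' g g', T f g -> T f' g' -> Defs.ae_eq f f' -> Defs.ae_eq g g'.

Lemma relpow_functional (R : realType) (T : (R -> R[i]) -> (R -> R[i]) -> Prop) n f g g' :
  ae_functional T -> relpow T n f g -> relpow T n f g' -> Defs.ae_eq g g'.
Proof.
move=> FT; elim: n g g' => [|n IHn] g g' /=.
  move=> [_ fg] [_ fg']; apply: ae_imply (ae_conj _ _ _ fg fg') => x [<- <-//].
by move=> [h [fh hg]] [h' [fh' hg']]; apply: (FT _ _ _ _ hg hg'); exact: IHn fh fh'.
Qed.

(** The powers [u n] obtained at [eps = 1] agree almost everywhere with those for any other [eps].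
    Pairing with [psi] therefore gives scalar series with coefficients [reinner psi (u n)]
    independent of [eps], and [scaled_series_limit] applies. *)
Lemma S_rel_weak_limit (R : realType) (T : (R -> R[i]) -> (R -> R[i]) -> Prop)
    (P : (R -> R[i]) -> Prop) (psi f tf : R -> R[i]) (S : R -> R -> R[i]) :
  ae_functional T -> (forall f g, T f g -> L2 g) -> L2 psi ->
  (forall eps, 0 < eps <= 1 -> S_rel T P eps f (S eps)) -> T f tf ->
  reinner psi (S eps) @[eps --> 0^'+] --> - reinner psi tf.
Proof.
move=> FT T2 psi2 ST Tf.
have L2_relpow n g : relpow T (2 * n + 1) f g -> L2 g.
  by rewrite addn1 => -[h [_ /T2]].
have [_ _ [u [uT _]]] : S_rel T P 1 f (S 1) by apply: ST; rewrite ltr01 lexx.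
have u2 n : L2 (u n) by apply: (L2_relpow n).
(* The exponent at index 0 is 1, so [u 0] is a representative of [T f]; it supplies the constant
   term. *)
have -> : reinner psi tf = reinner psi (u 0%N).
  apply: reinner_ae => //; first exact: (T2 _ _ Tf).
  have := uT 0%N; rewrite muln0 add0n /= => -[h [[_ fh] hu]].
  exact: (FT _ _ _ _ Tf hu).
(* Undoing the factor $-\varepsilon^{-1/2}$ gives the pairing of [psi] with the sum of the
   series. *)
pose L eps := - Num.sqrt eps * reinner psi (S eps).
have LE eps : 0 < eps <= 1 ->
    \sum_(n < N.+1) Scoef eps n * reinner psi (u n) @[N --> \oo] --> L eps.
  move=> e01; have [_ S2 [v [vT [l [[l2 vl] Sl]]]]] := ST eps e01.
  have s0 : 0 < Num.sqrt eps by rewrite sqrtr_gt0; case/andP: e01.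
  have v2 n : L2 (v n) by apply: (L2_relpow n).
  have uv n : reinner psi (u n) = reinner psi (v n).
    by apply: reinner_ae => //; exact: (relpow_functional _ _ _ _ _ _ FT (uT n) (vT n)).
  have -> : L eps = reinner psi l.
    rewrite /L (reinner_ae _ _ _ _ psi2 S2 _ Sl); last exact: L2Z.
    have -> : (fun x => - ((Num.sqrt eps)^-1)%:C * l x) =
        (fun x => (- (Num.sqrt eps)^-1)%:C * l x).
      by apply/funext => x; rewrite rmorphN.
    by rewrite reinnerZ//; field; exact: lt0r_neq0.
  under eq_fun do under eq_bigr do rewrite uv.
  under eq_fun do rewrite -reinner_sum//.
  by apply: reinner_cvg => // n; exact: (L2_sum _ (fun k => (Scoef eps k)%:C)).
apply: cvg_trans (scaled_series_limit R (fun n => reinner psi (u n)) L LE).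
apply: near_eq_cvg; near=> eps.
have s0 : 0 < Num.sqrt eps.
  by rewrite sqrtr_gt0; near: eps; exact: nbhs_right_gt.
by rewrite /L; field; exact: lt0r_neq0.
Unshelve. all: by end_near.
Qed.

(** * Single-valuedness of t and of its adjoint *)

Lemma ae_itv_ex (R : realType) (P : R -> Prop) (u v : R) :
  {ae @lebesgue_measure R, forall x, P x} -> u < v ->
  exists2 x, u < x < v & P x.
Proof.
move=> aeP uv; apply: contrapT => nP.
have : (@lebesgue_measure R).-negligible `]u, v[%classic.
  apply: negligibleS aeP => x /=; rewrite in_itv/= => xuv Px.
  by apply: nP; exists x.
move/measure_negligible => /(_ (measurable_itv _)) uv0.
have := lebesgue_measure_itv `]u, v[; rewrite /= lte_fin uv -EFinB => uvE.
have /eqP : (v - u)%:E = 0%E :> \bar R by rewrite -uvE; exact: uv0.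
by rewrite eqe subr_eq0 gt_eqF.
Qed.

(** If the derivative were nonzero, all difference quotients with small nonzero step would be
    nonzero; but points satisfying [P] lie arbitrarily close to the right of [x], and there the
    quotient is 0. *)
Lemma derive1_ae0 (R : realType) (F : R -> R) (P : R -> Prop) (x b : R) :
  {ae @lebesgue_measure R, forall y, P y} -> x < b ->
  (forall y, x <= y < b -> P y -> F y = 0) ->
  P x -> derivable F x 1 -> F^`()%classic x = 0.
Proof.
move=> aeP xb F0 Px dF; apply/eqP/negPn/negP => dFx.
have cvF : h^-1 *: (F (h *: 1 + x) - F x) @[h --> 0^'] --> F^`()%classic x.
  rewrite derive1E; exact: dF.
have /nbhs_ballP[e /= e0 H] : \forall h \near nbhs (0:R), h != 0 ->
    h^-1 *: (F (h *: 1 + x) - F x) != 0.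
  exact: (cvgr_neq0 _ cvF dFx).
have xm : x < Num.min (x + e) b by rewrite lt_min xb ltrDl e0.
have [y /andP[xy]] := ae_itv_ex _ _ _ _ aeP xm.
rewrite lt_min => /andP[ye yb] Py.
have := H (y - x); rewrite /ball/= sub0r normrN gtr0_norm ?subr_gt0//.
rewrite ltrBlDl subr_eq0 gt_eqF// => /(_ ye isT).
rewrite [_ *: 1]mulr1 subrK !F0 ?lexx ?xb ?yb ?(ltW xy)//.
by rewrite subrr scaler0 eqxx.
Qed.

(** A primitive of [k] started at a point of [P] vanishes at the later points of [P]. By Lebesgue
    differentiation its derivative is [k] almost everywhere, and [derive1_ae0] makes that derivative
    0. *)
Lemma ae0_of_itv_integral0 (R : realType) (k : R -> R) (P : R -> Prop) :
  {ae @lebesgue_measure R, forall x, P x} ->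
  (forall a b, (@lebesgue_measure R).-integrable `[a, b] (EFin \o k)) ->
  (forall a b, P a -> P b -> a < b ->
    Rintegral (@lebesgue_measure R) `[a, b] k = 0) ->
  {ae @lebesgue_measure R, forall x, k x = 0}.
Proof.
move=> aeP ik k0.
have step (n : nat) : {ae @lebesgue_measure R, forall x, - n%:R < x < n%:R -> k x = 0}.
  have [a /andP[_ an] Pa] := ae_itv_ex _ _ (- n%:R - 1) (- n%:R) aeP ltac:(lra).
  have [b /andP[nb _] Pb] := ae_itv_ex _ _ n%:R (n%:R + 1) aeP ltac:(lra).
  (* Integrability of [k] is given on bounded intervals only; cutting off outside [[a, b]], which
     contains []-n, n[], gives a function integrable on the whole line. *)
  have ikT : (@lebesgue_measure R).-integrable setT (EFin \o (k \_ `[a, b]%classic)).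
    by rewrite -restrict_EFin; apply/integrable_restrict => //; rewrite setTI.
  have ikN y : (@lebesgue_measure R).-integrable `]-oo, y] (EFin \o (k \_ `[a, b]%classic)).
    exact: integrableS ikT.
  have := FTC1Ny ikN (open_integrable_locally openT ikT).
  set F := (fun x : R => _) => dF.
  apply: ae_imply (ae_conj _ _ _ aeP dF) => x [Px [dFx Fx]] /andP[nx xn].
  have ax : a < x by exact: lt_trans nx.
  have xb : x < b by exact: lt_trans nb.
  rewrite patchE mem_set/= in Fx; last by rewrite in_itv/= !ltW.
  rewrite -Fx; apply: (derive1_ae0 _ _ _ _ _ aeP xb) => //.
  (* The primitive from $-\infty$ of the cut-off function is, at [y], the integral of [k] over
     [[a, y]], whose endpoints both satisfy [P]. *)
  move=> y /andP[xy yb] Py; rewrite /F -Rintegral_mkcondr.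
  have -> : `]-oo, y]%classic `&` `[a, b]%classic = `[a, y]%classic.
    apply/seteqP; split => z /=; rewrite !in_itv/=.
      by move=> [-> /andP[->]].
    by move=> /andP[-> zy]; split => //; rewrite (le_trans zy)// ltW.
  by apply: k0 => //; exact: lt_le_trans xy.
have : {ae @lebesgue_measure R, forall x (n : nat), - n%:R < x < n%:R -> k x = 0}.
  have := @negligible_bigcup _ _ _ (@lebesgue_measure R) _ step.
  apply: negligibleS => x /= /existsNP[n nx]; exists n => //.
apply: ae_imply => x /(_ (Num.truncn `|x|).+1); apply.
by rewrite -ltr_norml truncnS_gt.
Qed.

Lemma integrable_cst1_itv (R : realType) (a b : R) :
  (@lebesgue_measure R).-integrable `[a, b] (EFin \o cst (1 : R)).
Proof.
apply/integrableP; split; first by apply/measurable_EFinP; exact: measurable_cst.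
rewrite /= normr1 integral_cst//= mul1e lebesgue_measure_itv/=.
by case: ifP => _; rewrite -?EFinB ltry.
Qed.

(** Both $|\mathrm{Re} f|$ and $|\mathrm{Im} f|$ are at most $1+|f|^2$, and constants are integrable
    on a bounded interval. *)
Lemma L2_integrable_itv (R : realType) (f : R -> R[i]) (a b : R) : L2 f ->
  (@lebesgue_measure R).-integrable `[a, b] (EFin \o (fun x => Re (f x))) /\
  (@lebesgue_measure R).-integrable `[a, b] (EFin \o (fun x => Im (f x))).
Proof.
move=> f2; have [mfr mfi _] := f2.
have i1 : (@lebesgue_measure R).-integrable `[a, b] (EFin \o (fun x => 1 + sqmod (f x))).
  have i0 := integrable_cst1_itv _ a b.
  have i2 : (@lebesgue_measure R).-integrable `[a, b] (fun x => (sqmod (f x))%:E).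
    by apply: integrableS (L2_integrable _ _ f2).
  by apply: (integrableD _ i0 i2).
split; apply: le_integrable i1 => //.
- by apply/measurable_EFinP; exact: measurable_funTS.
- move=> x _ /=; rewrite lee_fin [leRHS]ger0_norm ?addr_ge0 ?sqr_ge0//.
  rewrite ler_norml /sqmod; have := sqr_ge0 (Im (f x)).
  have := sqr_ge0 (Re (f x) - 1); have := sqr_ge0 (Re (f x) + 1).
  by move=> *; apply/andP; split; lra.
- by apply/measurable_EFinP; exact: measurable_funTS.
- move=> x _ /=; rewrite lee_fin [leRHS]ger0_norm ?addr_ge0 ?sqr_ge0//.
  rewrite ler_norml /sqmod; have := sqr_ge0 (Re (f x)).
  have := sqr_ge0 (Im (f x) - 1); have := sqr_ge0 (Im (f x) + 1).
  by move=> *; apply/andP; split; lra.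
Qed.

(** Endpoints are confined to a set of full measure to suit both uses: for [t], the points where two
    primitives agree; for the adjoint, the nonzero points. *)
Lemma L2_ae_eq (R : realType) (f g : R -> R[i]) (P : R -> Prop) : L2 f -> L2 g ->
  {ae @lebesgue_measure R, forall x, P x} ->
  (forall a b, P a -> P b -> a < b -> cint `[a, b] f = cint `[a, b] g) ->
  Defs.ae_eq f g.
Proof.
move=> f2 g2 aeP fg.
have rfg : {ae @lebesgue_measure R, forall x, Re (f x) - Re (g x) = 0}.
  apply: (ae0_of_itv_integral0 _ _ P) => // a b.
    exact: (integrableB _ (L2_integrable_itv _ _ a b f2).1 (L2_integrable_itv _ _ a b g2).1).
  move=> Pa Pb ab; rewrite RintegralB//; last first.
  - exact: (L2_integrable_itv _ _ a b g2).1.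
  - exact: (L2_integrable_itv _ _ a b f2).1.
  by have [-> _] := fg a b Pa Pb ab; rewrite subrr.
have ifg : {ae @lebesgue_measure R, forall x, Im (f x) - Im (g x) = 0}.
  apply: (ae0_of_itv_integral0 _ _ P) => // a b.
    exact: (integrableB _ (L2_integrable_itv _ _ a b f2).2 (L2_integrable_itv _ _ a b g2).2).
  move=> Pa Pb ab; rewrite RintegralB//; last first.
  - exact: (L2_integrable_itv _ _ a b g2).2.
  - exact: (L2_integrable_itv _ _ a b f2).2.
  by have [_ ->] := fg a b Pa Pb ab; rewrite subrr.
apply: ae_imply (ae_conj _ _ _ rfg ifg) => x.
move=> [/eqP + /eqP]; rewrite !subr_eq0 => /eqP + /eqP.
by case: (f x) (g x) => [? ?] [? ?] /= -> ->.
Qed.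

(** The continuous representatives [F] and [F'] agree almost everywhere, so [h] and [h'] have equal
    integrals between points of agreement. Hence [h] and [h'] agree almost everywhere, and so do
    their quotients by [x]. *)
Lemma t_rel_functional (R : realType) : ae_functional (@t_rel R).
Proof.
move=> f f' g g' [h [[_ h2 [F [fF Fh]]] [_ _ gh]]] [h' [[_ h2' [F' [fF' Fh']]] [_ _ gh']]] ff'.
have FF' : {ae @lebesgue_measure R, forall x, F x = F' x}.
  by apply: ae_imply (ae_conj _ _ _ ff' (ae_conj _ _ _ fF fF')) => x [-> [<- <-]].
have hh' : Defs.ae_eq h h'.
  apply: (L2_ae_eq _ _ _ _ h2 h2' FF') => a b Fa Fb ab.
  have i0 : 'i != 0 :> R[i] by rewrite eq_complex /= oner_eq0 andbF.
  by apply: (mulfI i0); rewrite -Fh ?ltW// -Fh' ?ltW// Fa Fb.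
by apply: ae_imply (ae_conj _ _ _ hh' (ae_conj _ _ _ gh gh')) => x [hx [-> ->]]; rewrite hx.
Qed.

(** * Trapezoidal functions in the domain of t *)

(** For [u <= v] this is the projection onto [[u, v]]; as a function of [x] it is a primitive of the
    indicator of that interval. *)
Definition clamp {R : realType} (u v x : R) : R := Num.max u (Num.min v x).

Lemma clamp_itv (R : realType) (u v x : R) : u <= v -> u <= clamp u v x <= v.
Proof. by move=> uv; rewrite /clamp le_max lexx ge_max uv ge_min lexx. Qed.

Lemma clamp_below (R : realType) (u v x : R) : u <= v -> x <= u -> clamp u v x = u.
Proof. by move=> uv xu; rewrite /clamp (min_r (le_trans xu uv)) max_l. Qed.

Lemma clamp_above (R : realType) (u v x : R) : u <= v -> v <= x -> clamp u v x = v.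
Proof. by move=> uv vx; rewrite /clamp (min_l vx) max_r. Qed.

Lemma integrable_indic_itv (R : realType) (u v x y : R) :
  (@lebesgue_measure R).-integrable `[x, y] (EFin \o (\1_(`[u, v]%classic) : R -> R)).
Proof.
apply: le_integrable (integrable_cst1_itv _ x y) => //.
  by apply/measurable_EFinP; exact: measurable_indic.
by move=> t _ /=; rewrite lee_fin normr1 indicE; case: (_ \in _); rewrite ?normr1 ?normr0.
Qed.

Lemma Rintegral_indic_itv (R : realType) (u v x y : R) : u <= v -> x <= y ->
  Rintegral (@lebesgue_measure R) `[x, y] (\1_(`[u, v]%classic) : R -> R) =
  clamp u v y - clamp u v x.
Proof.
move=> uv xy; rewrite /Rintegral integral_indic//.
have -> : `[u, v]%classic `&` `[x, y]%classic =
    `[Num.max u x, Num.min v y]%classic :> set R.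
  apply/seteqP; split => t /=; rewrite !in_itv/= ge_max le_min.
    by move=> [/andP[-> ->] /andP[-> ->]].
  by move=> /andP[/andP[-> ->] /andP[-> ->]].
have := lebesgue_measure_itv `[Num.max u x, Num.min v y]; rewrite /= lte_fin -EFinB.
move=> muE; transitivity (fine (if Num.max u x < Num.min v y
    then (Num.min v y - Num.max u x)%:E else 0%E)); first by congr fine; exact: muE.
rewrite (fun_if fine) /= /clamp.
case: (leP v y) => vy; case: (leP v x) => vx; case: (leP u x) => ux;
  rewrite ?(max_r uv); case: (leP u y) => uy; case: ltP => ?; lra.
Qed.

Lemma L2_bounded (R : realType) (f : R -> R[i]) (a b M : R) :
  measurable_fun setT (fun x => Re (f x)) ->
  measurable_fun setT (fun x => Im (f x)) ->
  (forall x, sqmod (f x) <= M * \1_(`[a, b]%classic) x) -> L2 f.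
Proof.
move=> mr mi fM; apply: (integrable_L2 _ _ (fun x => M * \1_(`[a, b]%classic) x)) => //.
have i1 : (@lebesgue_measure R).-integrable setT
    (EFin \o (\1_(`[a, b]%classic) : R -> R)).
  rewrite (_ : (\1_(_) : R -> R) = (cst (1 : R)) \_ `[a, b]%classic); last first.
    by apply/funext => x; rewrite patchE indicE; case: ifPn.
  rewrite -restrict_EFin; apply/integrable_restrict => //.
  by rewrite setTI; exact: integrable_cst1_itv.
exact: (integrableZl measurableT M i1).
Qed.

(** For [0 < d] and [2 * d <= b - a] it rises linearly from 0 to 1 on [[a, a + d]], stays 1 up to
    [b - d], and falls to 0 at [b]. As a difference of two clamps it has a difference of indicators
    as derivative. *)
Definition trapezoid {R : realType} (a b d x : R) : R :=
  d^-1 * (clamp a (a + d) x - a) - d^-1 * (clamp (b - d) b x - (b - d)).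

(* The derivative of [trapezoid] outside the four corners. *)
Definition trapezoid' {R : realType} (a b d x : R) : R :=
  d^-1 * \1_(`[a, (a + d)]%classic) x - d^-1 * \1_(`[(b - d), b]%classic) x.

Lemma Rintegral_trapezoid' (R : realType) (a b d x y : R) : 0 < d -> x <= y ->
  (@lebesgue_measure R).-integrable `[x, y] (EFin \o trapezoid' a b d) /\
  Rintegral (@lebesgue_measure R) `[x, y] (trapezoid' a b d) =
  trapezoid a b d y - trapezoid a b d x.
Proof.
move=> d0 xy.
have i1 := integrable_indic_itv _ a (a + d) x y.
have i2 := integrable_indic_itv _ (b - d) b x y.
have j1 : (@lebesgue_measure R).-integrable `[x, y]
    (EFin \o (fun t => d^-1 * \1_(`[a, (a + d)]%classic) t)).
  by apply: (integrableZl _ d^-1 i1).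
have j2 : (@lebesgue_measure R).-integrable `[x, y]
    (EFin \o (fun t => d^-1 * \1_(`[(b - d), b]%classic) t)).
  by apply: (integrableZl _ d^-1 i2).
split; first by apply: (integrableB _ j1 j2).
rewrite /trapezoid' RintegralB// !RintegralZl// !Rintegral_indic_itv//; try lra.
by rewrite /trapezoid; ring.
Qed.

Lemma measurable_clamp (R : realType) (u v : R) : measurable_fun setT (clamp u v).
Proof.
by apply: measurable_maxr => //; apply: measurable_minr.
Qed.

Lemma measurable_trapezoid (R : realType) (a b d : R) :
  measurable_fun setT (trapezoid a b d).
Proof.
by apply: measurable_funB; apply: measurable_funM => //; apply: measurable_funB => //;
  exact: measurable_clamp.
Qed.

Lemma measurable_trapezoid' (R : realType) (a b d : R) :
  measurable_fun setT (trapezoid' a b d).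
Proof.
by apply: measurable_funB; apply: measurable_funM => //; exact: measurable_indic.
Qed.

Lemma trapezoid_bound (R : realType) (a b d x : R) : 0 < d -> 2 * d <= b - a ->
  0 <= trapezoid a b d x <= \1_(`]a, b[%classic) x.
Proof.
move=> d0 dab; have p0 : 0 < d^-1 by rewrite invr_gt0.
have dV : d^-1 * d = 1 by rewrite mulVf// gt_eqF.
rewrite /trapezoid indicE mem_setE in_itv /=.
have [xa|ax] := leP x a.
  by rewrite !clamp_below ?subrr ?mulr0 ?subr0 ?lexx//; lra.
have [bx|xb] := leP b x.
  rewrite !clamp_above; [|lra..].
  have -> : a + d - a = d by ring.
  have -> : b - (b - d) = d by ring.
  by rewrite dV subrr lexx.
rewrite /= mulr1n.
have [xad|adx] := leP x (a + d).
  rewrite [clamp (b - d) b x]clamp_below; [|lra..].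
  have /andP[c1 c2] := clamp_itv _ a (a + d) x ltac:(lra).
  rewrite subrr mulr0 subr0; apply/andP; split.
    by apply: mulr_ge0; [exact: ltW | lra].
  by rewrite -dV ler_pM2l//; lra.
rewrite [clamp a _ x]clamp_above; [|lra..].
have -> : a + d - a = d by ring.
have /andP[c1 c2] := clamp_itv _ (b - d) b x ltac:(lra).
rewrite dV subr_ge0 gerBl; apply/andP; split.
  by rewrite -dV ler_pM2l//; lra.
by apply: mulr_ge0; [exact: ltW | lra].
Qed.

Lemma trapezoid_plateau (R : realType) (a b d x : R) : 0 < d ->
  a + d <= x <= b - d -> trapezoid a b d x = 1.
Proof.
move=> d0 /andP[ax xb]; rewrite /trapezoid clamp_above; [|lra..].
rewrite clamp_below; [|lra..].
by field; exact: lt0r_neq0.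
Qed.

(* The last two hypotheses keep the support of [trapezoid'] at distance at least
   [d] from 0. *)
Lemma trapezoid'_bound (R : realType) (a b d x : R) : 0 < d -> 2 * d < b - a ->
  2 * d <= `|a| -> 2 * d <= `|b| ->
  `|trapezoid' a b d x| <= d^-1 * \1_(`[a, b]%classic) x /\
  `|trapezoid' a b d x / x| <= d^-1 * d^-1 * \1_(`[a, b]%classic) x.
Proof.
move=> d0 dab da db; have p0 : 0 < d^-1 by rewrite invr_gt0.
rewrite /trapezoid' !indicE !mem_setE !in_itv /=.
have [xad|nad] := boolP (a <= x <= a + d).
  have dx : d <= `|x|.
    have := ler_normD x (a - x); rewrite subrKC => h.
    have : `|a - x| <= d by case/andP: xad => ? ?; rewrite ler_norml; lra.
    by move=> ?; lra.
  have -> : a <= x <= b by case/andP: xad => ? ?; lra.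
  have -> : (b - d <= x <= b) = false by case/andP: xad => ? ?; apply/negbTE; lra.
  rewrite mulr0 subr0 !mulr1 normrM (gtr0_norm p0) normfV lexx; split => //.
  by rewrite ler_pM2l// lef_pV2// posrE// (lt_le_trans d0).
have [xbd|nbd] := boolP (b - d <= x <= b).
  have dx : d <= `|x|.
    have := ler_normD x (b - x); rewrite subrKC => h.
    have : `|b - x| <= d by case/andP: xbd => ? ?; rewrite ler_norml; lra.
    by move=> ?; lra.
  have -> : a <= x <= b by case/andP: xbd => ? ?; lra.
  rewrite mulr0 sub0r !mulr1 normrM normrN (gtr0_norm p0) normfV lexx; split => //.
  by rewrite ler_pM2l// lef_pV2// posrE// (lt_le_trans d0).
by rewrite !mulr0 subrr mul0r normr0 !mulr_ge0// ?ltW// mulr_gt0.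
Qed.

(** Writing $1/x=x\,(x^2)^{-1}$ reduces the claim to real powers; at [x = 0] both sides are 0, by
    the convention that the inverse of 0 is 0. *)
Lemma measurable_inv (R : realType) : measurable_fun setT (fun x : R => x^-1).
Proof.
rewrite (_ : (fun _ => _) = (fun x => x * (x ^+ 2) `^ (-1))).
  apply: measurable_funM => //.
  apply: (@measurableT_comp _ _ _ _ _ _ (fun y : R => y `^ (-1)) setT (fun x : R => x ^+ 2)).
    exact: measurable_powR.
  exact: exprn_measurable.
apply/funext => x; rewrite powR_inv1 ?sqr_ge0//.
by have [->|x0] := eqVneq x 0; [rewrite invr0 mul0r | field].
Qed.

Lemma L2_real_bounded (R : realType) (z : R[i]) (r : R -> R) (a b M : R) :
  measurable_fun setT r -> (forall x, `|r x| <= M * \1_(`[a, b]%classic) x) ->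
  L2 (fun x => z * (r x)%:C).
Proof.
move=> mr rM; apply: L2Z; apply: (L2_bounded _ _ a b (M ^+ 2)) => //=.
move=> x; rewrite /sqmod /= expr0n /= addr0 -real_normK ?num_real//.
have := rM x; rewrite indicE; case: (_ \in _) => /= h.
  rewrite !mulr1 in h *; rewrite ler_sqr ?nnegrE//.
  exact: le_trans h.
rewrite !mulr0 in h *; have -> : `|r x| = 0 by apply/eqP; rewrite eq_le h /=.
by rewrite expr0n.
Qed.

Lemma cint_mull (R : realType) (z : R[i]) (r : R -> R) (a b : R) :
  (@lebesgue_measure R).-integrable `[a, b] (EFin \o r) ->
  cint `[a, b] (fun x => z * (r x)%:C) =
  z * (Rintegral (@lebesgue_measure R) `[a, b] r)%:C.
Proof.
move=> ir; case: z => u v; apply/eqP; rewrite eq_complex /= !mulr0 subr0 add0r.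
rewrite -!RintegralZl//; apply/andP; split; apply/eqP; apply: eq_Rintegral => x _.
  by rewrite subr0.
by rewrite add0r.
Qed.

(** Since [trapezoid'] vanishes near 0, division by [x] keeps it bounded with bounded support, even
    when the trapezoid itself equals 1 at 0. The values 1 and ['i] of [c] later test real and
    imaginary parts. *)
Lemma t_rel_trapezoid (R : realType) (c : R[i]) (a b d : R) : 0 < d ->
  2 * d < b - a -> 2 * d <= `|a| -> 2 * d <= `|b| ->
  t_rel (fun x => c * (trapezoid a b d x)%:C)
        (fun x => - 'i * c * (trapezoid' a b d x / x)%:C).
Proof.
move=> d0 dab da db; have sb x := trapezoid'_bound _ a b d x d0 dab da db.
have h2 : L2 (fun x => - 'i * c * (trapezoid' a b d x)%:C).
  apply: (L2_real_bounded _ _ _ a b d^-1) => [|x].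
    exact: measurable_trapezoid'.
  exact: (sb x).1.
exists (fun x => - 'i * c * (trapezoid' a b d x)%:C); split; split => //.
- apply: (L2_real_bounded _ _ _ a b 1) => [|x]; first exact: measurable_trapezoid.
  have /andP[t0 t1] := trapezoid_bound _ a b d x d0 (ltW dab).
  rewrite mul1r ger0_norm//; apply: (le_trans t1).
  rewrite !indicE !mem_setE !in_itv /=; have [/andP[ax xb]|_] := boolP (a < x < b).
    by rewrite (ltW ax) (ltW xb) lexx.
  by rewrite ler0n.
- exists (fun x => c * (trapezoid a b d x)%:C); split.
    by apply: ae_all => x.
  move=> x y xy; have [itr trE] := Rintegral_trapezoid' _ a b d x y d0 xy.
  rewrite cint_mull// trE; move: (trapezoid a b d y) (trapezoid a b d x) => u v.
  rewrite rmorphB /= mulrA mulrA.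
  have -> : 'i * - 'i = 1 :> R[i] by rewrite mulrN -expr2 sqr_i opprK.
  by rewrite mul1r mulrBr.
- apply: (L2_real_bounded _ _ _ a b (d^-1 * d^-1)) => [|x]; last exact: (sb x).2.
  apply: measurable_funM; [exact: measurable_trapezoid' | exact: measurable_inv].
- by apply: ae_all => x /=; rewrite rmorphM fmorphV mulrA.
Qed.

(** As the ramps shrink, the trapezoids converge to the indicator of []a, b[], and the integrands
    are dominated by [|k|]. Nonzero endpoints leave room for ramps away from 0. *)
Lemma itv_integral0_of_trapezoid (R : realType) (k : R -> R) (a b : R) :
  a < b -> a != 0 -> b != 0 -> measurable_fun setT k ->
  (@lebesgue_measure R).-integrable `[a, b] (EFin \o k) ->
  (forall d, 0 < d -> 2 * d < b - a -> 2 * d <= `|a| -> 2 * d <= `|b| ->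
    Rintegral (@lebesgue_measure R) setT (fun x => k x * trapezoid a b d x) = 0) ->
  Rintegral (@lebesgue_measure R) `[a, b] k = 0.
Proof.
move=> ab a0 b0 mk ik kT.
(* A third of the minimum, so that every ramp width up to [d0] meets all three conditions, the
   strict one included. *)
pose d0 := Num.min (Num.min `|a| `|b|) (b - a) / 3.
have [d00 d0ab d0a d0b] : [/\ 0 < d0, 3 * d0 <= b - a, 3 * d0 <= `|a| & 3 * d0 <= `|b|].
  have d03 : 3 * d0 = Num.min (Num.min `|a| `|b|) (b - a) by rewrite /d0; field.
  rewrite d03 !ge_min !lexx !orbT; split => //.
  by rewrite /d0 divr_gt0// !lt_min !normr_gt0 a0 b0 subr_gt0.
pose d n := d0 / n.+1%:R.
have dd n : 0 < d n <= d0.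
  by rewrite /d divr_gt0//= ler_pdivrMr// ler_peMr ?ler1n// ltW.
have iko : (@lebesgue_measure R).-integrable `]a, b[ (EFin \o k).
  by apply: integrableS ik => //; exact: subset_itv_oo_cc.
have bound n x : 0 <= trapezoid a b (d n) x <= \1_(`]a, b[%classic) x.
  by have /andP[? ?] := dd n; apply: trapezoid_bound => //; lra.
have mkT n : measurable_fun setT (fun x => k x * trapezoid a b (d n) x).
  by apply: measurable_funM => //; exact: measurable_trapezoid.
have kTle n x : `|k x * trapezoid a b (d n) x| <= `|k x|.
  have /andP[t0 t1] := bound n x; rewrite normrM (ger0_norm t0) ler_piMr//.
  by apply: (le_trans t1); rewrite indicE; case: (_ \in _).
have ikT n : (@lebesgue_measure R).-integrable `]a, b[
    (EFin \o (fun x => k x * trapezoid a b (d n) x)).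
  apply: le_integrable iko => //.
    by apply/measurable_EFinP; apply: measurable_funTS; exact: mkT.
  by move=> x _ /=; rewrite lee_fin.
have int0 n : (\int[@lebesgue_measure R]_(x in `]a, b[)
    (k x * trapezoid a b (d n) x)%:E = 0)%E.
  rewrite -[LHS]fineK; last by apply: integrable_fin_num => //; exact: ikT.
  have /andP[? ?] := dd n.
  congr EFin; transitivity (Rintegral (@lebesgue_measure R) setT
      (fun x => k x * trapezoid a b (d n) x)); last by apply: kT; lra.
  rewrite -[LHS]/(Rintegral lebesgue_measure `]a, b[
    (fun x => k x * trapezoid a b (d n) x)) Rintegral_mkcond.
  congr Rintegral; apply/funext => x; rewrite patchE; case: ifPn => // xab.
  have := bound n x; rewrite indicE (negbTE xab) -eq_le => /eqP <-.
  by rewrite mulr0.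
have [|||||_ _] := @dominated_convergence _ _ _ (@lebesgue_measure R) `]a, b[%classic
    (measurable_itv _) (fun n x => (k x * trapezoid a b (d n) x)%:E)
    (EFin \o k) (fun x => `|(k x)%:E|%E).
- by move=> n; apply/measurable_EFinP; apply: measurable_funTS; exact: mkT.
- by apply/measurable_EFinP; exact: measurable_funTS.
- apply: ae_all => x; rewrite /= in_itv/= => /andP[ax xb].
  (* Once the ramp is no wider than the distance [m] from [x] to the endpoints, [x] lies on the
     plateau and the sequence is constant. *)
  apply: cvg_near_cst; pose m := Num.min (x - a) (b - x).
  have m0 : 0 < m by rewrite lt_min !subr_gt0 ax.
  exists (Num.truncn (d0 / m)) => // n /= nm.
  have dm : d n <= m.
    rewrite /d ler_pdivrMr// mulrC -ler_pdivrMr// ltW//.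
    by rewrite (lt_le_trans (truncnS_gt _))// ler_nat.
  have /andP[dn0 _] := dd n.
  have : m <= x - a by rewrite /m ge_min lexx.
  have : m <= b - x by rewrite /m ge_min lexx orbT.
  by move=> *; rewrite trapezoid_plateau ?mulr1//; lra.
- exact: integrable_abse.
- by apply: ae_all => x n _; rewrite /= lee_fin.
under eq_fun do rewrite int0.
move=> lim0.
have k0 : (\int[@lebesgue_measure R]_(x in `]a, b[) (k x)%:E = 0)%E.
  exact: (cvg_unique (@ereal_hausdorff R) lim0 (cvg_cst 0%E)).
rewrite -Rintegral_itv_bndo_bndc; last first.
  by apply: integrableS ik => //; exact: subset_itv_co_cc.
by rewrite -Rintegral_itv_obnd_cbnd// /Rintegral k0.
Qed.

(** The difference [h - h'] pairs to 0 with every element of the domain of [t], in particular with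
    the trapezoids. Its integral over any interval with nonzero endpoints is therefore 0. *)
Lemma tstar_rel_functional (R : realType) : ae_functional (@tstar_rel R).
Proof.
move=> g g' h h' [g2 h2 gh] [g2' h2' gh'] gg'.
have weak f k : t_rel f k -> reinner (fun x => h x - h' x) f = 0.
  move=> tfk; have [_ [[f2 _ _] [_ k2 _]]] := tfk.
  rewrite reinnerC reinnerB// ![reinner f _]reinnerC -!Re_inner.
  by rewrite -(gh _ _ tfk) -(gh' _ _ tfk) !Re_inner ![reinner _ k]reinnerC
    (reinner_ae _ _ _ _ k2 g2 g2' gg') subrr.
have neq0 : {ae @lebesgue_measure R, forall x, x != 0}.
  exists [set 0]; split => //; first exact: lebesgue_measure_set1.
  by move=> x /= /negP; rewrite negbK => /eqP.
apply: (L2_ae_eq _ _ _ _ h2 h2' neq0) => a b a0 b0 ab.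
have [irh iih] := L2_integrable_itv _ _ a b h2.
have [irh' iih'] := L2_integrable_itv _ _ a b h2'.
have [mrh mih _] := h2; have [mrh' mih' _] := h2'.
have re0 : Rintegral (@lebesgue_measure R) `[a, b] (fun x => Re (h x) - Re (h' x)) = 0.
  apply: itv_integral0_of_trapezoid => //.
  - exact: measurable_funB.
  - by apply: (integrableB _ irh irh').
  - move=> d d0 dab da db; rewrite -[RHS](weak _ _ (t_rel_trapezoid _ 1 a b d d0 dab da db)).
    by apply: eq_Rintegral => x _; case: (h x) (h' x) => [? ?] [? ?] /=; ring.
have im0 : Rintegral (@lebesgue_measure R) `[a, b] (fun x => Im (h x) - Im (h' x)) = 0.
  apply: itv_integral0_of_trapezoid => //.
  - exact: measurable_funB.
  - by apply: (integrableB _ iih iih').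
  - move=> d d0 dab da db; rewrite -[RHS](weak _ _ (t_rel_trapezoid _ 'i a b d d0 dab da db)).
    by apply: eq_Rintegral => x _; case: (h x) (h' x) => [? ?] [? ?] /=; ring.
move: re0 im0; rewrite !RintegralB// /cint => /eqP + /eqP.
by rewrite !subr_eq0 => /eqP -> /eqP ->.
Qed.

(** * Convergence of the forms *)

Lemma ReD (R : realType) (z w : R[i]) : Re (z + w) = Re z + Re w.
Proof. by case: z w => ? ? []. Qed.

Lemma ImD (R : realType) (z w : R[i]) : Im (z + w) = Im z + Im w.
Proof. by case: z w => ? ? []. Qed.

Lemma Re_half (R : realType) (z : R[i]) : Re (2%:R^-1 * z) = 2^-1 * Re z.
Proof.
have -> : 2%:R^-1 = (2^-1)%:C :> R[i] by rewrite fmorphV rmorph_nat.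
by case: z => a b /=; rewrite mul0r subr0.
Qed.

Lemma Im_half (R : realType) (z : R[i]) : Im (2%:R^-1 * z) = 2^-1 * Im z.
Proof.
have -> : 2%:R^-1 = (2^-1)%:C :> R[i] by rewrite fmorphV rmorph_nat.
by case: z => a b /=; rewrite mul0r addr0.
Qed.

(** The even and odd parts of the form have the same shape, with [T] equal to [t_rel] or
    [tstar_rel]. In each term the factor depending on [eps] is moved to the second slot of
    [reinner], where [S_rel_weak_limit] applies. *)
Lemma S_rel_inner_limit (R : realType) (T : (R -> R[i]) -> (R -> R[i]) -> Prop)
    (P : (R -> R[i]) -> Prop) (psi phi tpsi tphi : R -> R[i])
    (Spsi Sphi : R -> R -> R[i]) :
  ae_functional T -> (forall f g, T f g -> L2 g) -> L2 psi -> L2 phi ->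
  (forall eps, 0 < eps <= 1 -> S_rel T P eps psi (Spsi eps)) ->
  (forall eps, 0 < eps <= 1 -> S_rel T P eps phi (Sphi eps)) ->
  T psi tpsi -> T phi tphi ->
  Re (2%:R^-1 * (inner psi (Sphi eps) + inner (Spsi eps) phi)) @[eps --> 0^'+] -->
    Re (- (2%:R^-1 * (inner psi tphi + inner tpsi phi))) /\
  Im (2%:R^-1 * (inner psi (Sphi eps) + inner (Spsi eps) phi)) @[eps --> 0^'+] -->
    Im (- (2%:R^-1 * (inner psi tphi + inner tpsi phi))).
Proof.
move=> FT T2 psi2 phi2 Hpsi Hphi Tpsi Tphi.
have lim_phi f : L2 f -> reinner f (Sphi eps) @[eps --> 0^'+] --> - reinner f tphi.
  by move=> f2; exact: (S_rel_weak_limit _ _ _ _ _ _ _ FT T2 f2 Hphi Tphi).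
have lim_psi f : L2 f -> reinner f (Spsi eps) @[eps --> 0^'+] --> - reinner f tpsi.
  by move=> f2; exact: (S_rel_weak_limit _ _ _ _ _ _ _ FT T2 f2 Hpsi Tpsi).
have ReN z : Re (- z) = - Re z :> R by case: z.
have ImN z : Im (- z) = - Im z :> R by case: z.
split.
  rewrite ReN Re_half ReD !Re_inner [reinner tpsi _]reinnerC -mulrN opprD.
  under eq_fun do rewrite Re_half ReD !Re_inner [reinner _ phi]reinnerC.
  by apply: cvgMl_tmp; apply: cvgD; [exact: lim_phi | exact: lim_psi].
rewrite ImN Im_half ImD Im_inner Im_innerC -mulrN opprD.
under eq_fun do rewrite Im_half ImD Im_inner Im_innerC.
by apply: cvgMl_tmp; apply: cvgD; [apply: lim_phi | apply: lim_psi]; exact: L2Z.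
Qed.

(* psi = psi0 (+) psi1, phi = phi0 (+) phi1 in M = M_0 (+) M_1.
   Spsi0 eps, Sphi0 eps are (representatives of) S_eps psi0, S_eps phi0;
   Spsi1 eps, Sphi1 eps are S^*_eps psi1, S^*_eps phi1  (0 < eps <= 1);
   tpsi0, tphi0 are t psi0, t phi0; tpsi1, tphi1 are t^* psi1, t^* phi1. *)
Theorem theorem5p1 (R : realType) (psi0 psi1 phi0 phi1 : R -> R[i])
  (Spsi0 Sphi0 Spsi1 Sphi1 : R -> R -> R[i])
  (tpsi0 tphi0 tpsi1 tphi1 : R -> R[i]) :
  M0 psi0 -> M1 psi1 -> M0 phi0 -> M1 phi1 ->
  (forall eps : R, 0 < eps <= 1 -> S_rel t_rel even_L2 eps psi0 (Spsi0 eps)) ->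
  (forall eps : R, 0 < eps <= 1 -> S_rel t_rel even_L2 eps phi0 (Sphi0 eps)) ->
  (forall eps : R, 0 < eps <= 1 -> S_rel tstar_rel odd_L2 eps psi1 (Spsi1 eps)) ->
  (forall eps : R, 0 < eps <= 1 -> S_rel tstar_rel odd_L2 eps phi1 (Sphi1 eps)) ->
  t_rel psi0 tpsi0 -> t_rel phi0 tphi0 ->
  tstar_rel psi1 tpsi1 -> tstar_rel phi1 tphi1 ->
  let lhs := fun eps : R =>
    t_eps_form psi0 psi1 phi0 phi1 (Spsi0 eps) (Sphi0 eps) (Spsi1 eps) (Sphi1 eps) in
  let rhs := t_AB_form psi0 psi1 phi0 phi1 tpsi0 tphi0 tpsi1 tphi1 in
  Re (lhs eps) @[eps --> 0^'+] --> Re rhs /\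
  Im (lhs eps) @[eps --> 0^'+] --> Im rhs.
Proof.
move=> _ _ _ _ Spsi0E Sphi0E Spsi1E Sphi1E tpsi0E tphi0E tpsi1E tphi1E lhs rhs.
have one : 0 < (1 : R) <= 1 by rewrite ltr01 lexx.
(* Square integrability is part of membership in the even or odd subspace, read off here at
   [eps = 1]. *)
have [[psi02 _] _ _] := Spsi0E 1 one; have [[phi02 _] _ _] := Sphi0E 1 one.
have [[psi12 _] _ _] := Spsi1E 1 one; have [[phi12 _] _ _] := Sphi1E 1 one.
have t2 (f g : R -> R[i]) : t_rel f g -> L2 g by move=> [h [_ [_ ? _]]].
have ts2 (f g : R -> R[i]) : tstar_rel f g -> L2 g by move=> [_ ? _].
have [re0 im0] := S_rel_inner_limit _ _ _ _ _ _ _ _ _ (t_rel_functional R) t2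
  psi02 phi02 Spsi0E Sphi0E tpsi0E tphi0E.
have [re1 im1] := S_rel_inner_limit _ _ _ _ _ _ _ _ _ (tstar_rel_functional R) ts2
  psi12 phi12 Spsi1E Sphi1E tpsi1E tphi1E.
rewrite {}/lhs {}/rhs /t_eps_form /t_AB_form; split.
  by rewrite ReD; under eq_fun do rewrite ReD; exact: cvgD.
by rewrite ImD; under eq_fun do rewrite ImD; exact: cvgD.
Qed.
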